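(* Let $p$ be an odd prime and let $F$ and $H$ be circulant graphs, each with $p$ vertices. If $F$ and $H$ are singularly cospectral, then $F$ and $H$ are isomorphic.
   Context: A circulant graph of order $n$ is a graph isomorphic to some $G(\mathbb{Z}_n,S)$, where $S\subseteq\mathbb{Z}_n\setminus\{0\}$ with $S=-S$, the vertex set is $\mathbb{Z}_n$, and $i,j$ are adjacent iff $j-i\in S$. Two graphs on the same number of vertices are singularly cospectral if the multisets of absolute values of their nonzero adjacency eigenvalues (counted with multiplicity) coincide. *)

(* Defs.v *)
From HB Require Import structures.
From mathcomp Require Import all_boot all_order all_algebra all_field.

Set Implicit Arguments.
Unset Strict Implicit.
Unset Printing Implicit Defensive.

Import Order.TTheory GRing.Theory Num.Theory.

Local Open Scope ring_scope.

Record sgraph := SGraph {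
  vertex :> finType;
  adj : rel vertex;
  adj_sym : symmetric adj;
  adj_irr : irreflexive adj
}.

Definition graph_iso (F H : sgraph) : Prop :=
  exists2 f : F -> H, bijective f & {mono f : x y / adj x y}.

(* Z_n is ['I_n] with its canonical additive group structure, which requires
   n to be a successor; unlike ['Z_n], this is correct for n = 1 as well. *)
Definition circ_adj (m : nat) (S : {set 'I_m.+1}) : rel 'I_m.+1 :=
  fun i j => j - i \in S.

Lemma circ_adj_sym (m : nat) (S : {set 'I_m.+1}) :
  S = [set - x | x in S] -> symmetric (circ_adj S).
Proof.
move=> SN i j; rewrite /circ_adj {1}SN -[j - i]opprB mem_imset //.
exact: oppr_inj.
Qed.

Lemma circ_adj_irr (m : nat) (S : {set 'I_m.+1}) :
  0 \notin S -> irreflexive (circ_adj S).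
Proof. by move=> S0 i; rewrite /circ_adj subrr; apply: negbTE. Qed.

Definition circ_graph (m : nat) (S : {set 'I_m.+1})
    (S0 : 0 \notin S) (SN : S = [set - x | x in S]) : sgraph :=
  SGraph (circ_adj_sym SN) (circ_adj_irr S0).

Definition circulant (n : nat) (G : sgraph) : Prop :=
  exists (m : nat) (S : {set 'I_m.+1})
         (S0 : 0 \notin S) (SN : S = [set - x | x in S]),
    n = m.+1 /\ graph_iso G (circ_graph S0 SN).

(* Vertices are indexed through their enumeration; the spectrum does not depend
   on that choice.  Eigenvalues of an integer matrix are algebraic, so [algC]
   contains all of them. *)
Definition adj_mx (G : sgraph) : 'M[algC]_#|G| :=
  \matrix_(i, j) (adj (enum_val i) (enum_val j))%:R.

(* The roots of the (monic) characteristic polynomial, with multiplicity. *)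
Definition spectrum (n : nat) (A : 'M[algC]_n) : seq algC :=
  sval (closed_field_poly_normal (char_poly A)).

Lemma spectrumE (n : nat) (A : 'M[algC]_n) :
  char_poly A = \prod_(x <- spectrum A) ('X - x%:P).
Proof.
rewrite /spectrum; case: (closed_field_poly_normal _) => r /= {1}->.
by rewrite (monicP (char_poly_monic A)) scale1r.
Qed.

Definition nz_abs_spectrum (G : sgraph) : seq algC :=
  [seq `|x| | x <- spectrum (adj_mx G) & x != 0].

Definition singularly_cospectral (F H : sgraph) : Prop :=
  #|F| = #|H| /\ perm_eq (nz_abs_spectrum F) (nz_abs_spectrum H).

(* Main.v *)
Require Import Defs.
From HB Require Import structures.
From mathcomp Require Import all_boot all_order all_algebra all_field.

(** The eigenvalues of the circulant graph on Z_p with connection set S are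
    the real numbers l_k(S) = \sum_(s in S) w^(k s), w a primitive p-th root of
    unity.  If S is nonempty then l_1(S) is nonzero, so |l_1(S)| = |l_k(T)|,
    i.e. l_1(S) = e l_k(T) with e = 1 or -1, for some k.  As 1 + X + ... +
    X^(p-1) is the minimal polynomial of w, the only rational relations between
    1, w, ..., w^(p-1) have constant coefficients; comparing coefficients, with
    0 not in S, forces e = 1, k <> 0 and S = k T, and multiplication by k is an
    isomorphism. *)

Set Implicit Arguments.
Unset Strict Implicit.
Unset Printing Implicit Defensive.

Import Order.TTheory GRing.Theory Num.Theory.

Local Open Scope ring_scope.

(** * Isomorphism invariance of adjacency eigenvalues *)

Lemma graph_iso_sym F H : graph_iso F H -> graph_iso H F.
Proof.
case=> f [g fK gK] mono_f; exists g; first by exists f.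
by move=> x y; rewrite -mono_f !gK.
Qed.

Lemma graph_iso_trans F G H : graph_iso F G -> graph_iso G H -> graph_iso F H.
Proof.
case=> f bij_f mono_f [g bij_g mono_g]; exists (g \o f); first exact: bij_comp.
by move=> x y /=; rewrite mono_g mono_f.
Qed.

(** Removes the enumeration of the vertices: eigenvectors become functions on [G], which an
    isomorphism carries over by composition. *)
Lemma eigenvalue_adj_mxP (G : sgraph) (a : algC) :
  reflect (exists2 f : G -> algC,
             forall y, \sum_x f x * (adj x y)%:R = a * f y
             & exists x, f x != 0)
          (eigenvalue (adj_mx G) a).
Proof.
apply: (iffP eigenvalueP) => [[v vA nz_v] | [f fA [x nz_fx]]].
  exists (fun x => v 0 (enum_rank x)) => [y|].
    have /rowP/(_ (enum_rank y)) := vA; rewrite !mxE => <-.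
    rewrite (reindex (@enum_val _ G)) /=; last exact/onW_bij/enum_val_bij.
    by apply: eq_bigr => i _; rewrite mxE enum_valK enum_rankK.
  have [i nz_vi] : exists i, v 0 i != 0.
    apply/existsP; apply: contraNT nz_v; rewrite negb_exists => /forallP v0.
    by apply/eqP/rowP => i; rewrite mxE; apply/eqP/negPn/v0.
  by exists (enum_val i); rewrite enum_valK.
exists (\row_i f (enum_val i)).
  apply/rowP => j; rewrite !mxE -fA.
  rewrite [RHS](reindex (@enum_val _ G)) /=; last exact/onW_bij/enum_val_bij.
  by apply: eq_bigr => i _; rewrite !mxE.
apply: contraNneq nz_fx => /rowP/(_ (enum_rank x)).
by rewrite !mxE enum_rankK => ->.
Qed.

Lemma graph_iso_eigenvalue (F H : sgraph) (a : algC) :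
  graph_iso F H -> eigenvalue (adj_mx F) a -> eigenvalue (adj_mx H) a.
Proof.
case=> f [g fK gK] mono_f /eigenvalue_adj_mxP[u uA [x nz_ux]].
apply/eigenvalue_adj_mxP; exists (u \o g); last by exists (f x); rewrite /= fK.
move=> y /=; rewrite -uA (reindex f) /=; last by apply: onW_bij; exists g.
by apply: eq_bigr => z _; rewrite fK -{1}(gK y) mono_f.
Qed.

Lemma mem_spectrum n (A : 'M[algC]_n) a : (a \in spectrum A) = eigenvalue A a.
Proof. by rewrite eigenvalue_root_char spectrumE root_prod_XsubC. Qed.

Lemma nz_abs_spectrumP (G : sgraph) (b : algC) :
  reflect (exists a, [/\ eigenvalue (adj_mx G) a, a != 0 & b = `|a|])
          (b \in nz_abs_spectrum G).
Proof.
apply: (iffP mapP) => [[a] | [a [Ga nz_a ->]]].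
  by rewrite mem_filter mem_spectrum => /andP[nz_a Ga] ->; exists a.
by exists a => //; rewrite mem_filter nz_a mem_spectrum.
Qed.

(** * Eigenvalues of circulant graphs as character sums *)

Definition circ_eig (m : nat) (w : algC) (S : {set 'I_m.+1}) (k : nat) : algC :=
  \sum_(s in S) w ^+ (k * s).

Section CirculantSpectrum.

Variables (m : nat) (w : algC).
Hypothesis prim_w : m.+1.-primitive_root w.

Implicit Types (S T : {set 'I_m.+1}) (k : nat).

Lemma prim_exprM_mod k i : w ^+ (k * (i %% m.+1)) = w ^+ (k * i).
Proof.
by rewrite -(prim_expr_mod prim_w) modnMmr (prim_expr_mod prim_w).
Qed.

Lemma prim_exprM_add k (x y : 'I_m.+1) :
  w ^+ (k * (x + y)%R) = w ^+ (k * x) * w ^+ (k * y).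
Proof. by rewrite /= prim_exprM_mod mulnDr exprD. Qed.

Lemma prim_expr_mulrn k (x : 'I_m.+1) : w ^+ (x *+ k) = w ^+ (k * x).
Proof. by rewrite Zp_mulrn /= (prim_expr_mod prim_w) mulnC. Qed.

Lemma prim_root_neq0 : w != 0.
Proof. by rewrite (prim_root_eq0 prim_w). Qed.

Lemma conjC_prim_root : w^* = w^-1.
Proof.
have /eqP : `|w| ^+ m.+1 = 1 by rewrite -normrX (prim_expr_order prim_w) normr1.
rewrite pexpr_eq1 // => /eqP w1.
by rewrite invC_norm w1 expr1n invr1 mul1r.
Qed.

(** Conjugation inverts [w], so it replaces each term at s by the term at -s, and S = -S. Reality is
    what later turns equal absolute values into equality up to sign. *)
Lemma circ_eig_real S k :
  S = [set - x | x in S] -> circ_eig w S k \is Num.real.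
Proof.
move=> SN; rewrite CrealE /circ_eig {2}SN big_imset /=; last first.
  by move=> x y _ _; apply: oppr_inj.
rewrite rmorph_sum /=; apply/eqP/eq_bigr => s _.
rewrite rmorphXn /= conjC_prim_root exprVn.
have nz_ws : w ^+ (k * s) != 0 by rewrite expf_neq0 // prim_root_neq0.
apply: (mulIf nz_ws); rewrite mulVf //.
by rewrite -(prim_exprM_add k (- s) s) addNr muln0 expr0.
Qed.

Lemma sum_prim_expr_adj S k (x : 'I_m.+1) :
  \sum_y (circ_adj S x y)%:R * w ^+ (k * y) = w ^+ (k * x) * circ_eig w S k.
Proof.
rewrite (reindex (+%R x)); last first.
  by apply: onW_bij; exists (+%R (- x)); [apply: addKr | apply: addNKr].
rewrite mulr_sumr [RHS]big_mkcond; apply: eq_bigr => y _.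
rewrite /circ_adj addrAC subrr add0r prim_exprM_add.
by case: ifP; rewrite ?mul1r ?mul0r.
Qed.

(** The character x -> w^(k x) of Z_n is an eigenfunction. *)
Lemma eigenvalue_circ_eig S (S0 : 0 \notin S) (SN : S = [set - x | x in S]) k :
  eigenvalue (adj_mx (circ_graph S0 SN)) (circ_eig w S k).
Proof.
apply/eigenvalue_adj_mxP; exists (fun x : 'I_m.+1 => w ^+ (k * x)).
  move=> y; rewrite mulrC -sum_prim_expr_adj; apply: eq_bigr => x _.
  by rewrite mulrC (adj_sym (s := circ_graph S0 SN)).
by exists 0; rewrite expf_neq0 // prim_root_neq0.
Qed.

(* The discrete Fourier transform of an eigenfunction is supported on the k
   with [a = circ_eig w S k], and it is nonzero because a nonzero polynomial of
   degree at most m cannot vanish at all the m+1 powers of w. *)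
Lemma eigenvalue_circP S (S0 : 0 \notin S) (SN : S = [set - x | x in S]) a :
  eigenvalue (adj_mx (circ_graph S0 SN)) a -> exists k, a = circ_eig w S k.
Proof.
case/eigenvalue_adj_mxP => /= v vA [x nz_vx].
(* The value of [q] at w^k is the Fourier transform of [v] at k. *)
pose q := \poly_(i < m.+1) v (inord i).
have qE k : q.[w ^+ k] = \sum_(i < m.+1) v i * w ^+ (k * i).
  rewrite horner_poly; apply: eq_bigr => i _.
  by rewrite inord_val exprM.
have nz_q : q != 0.
  apply: contraNneq nz_vx => /polyP/(_ x).
  by rewrite coef_poly ltn_ord inord_val coef0 => ->.
have [k nz_qk] : exists k : 'I_m.+1, q.[w ^+ k] != 0.
  apply/existsP; apply: contraNT nz_q; rewrite negb_exists => /forallP q0.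
  apply/eqP; apply: (@roots_geq_poly_eq0 _ q [seq w ^+ i | i <- iota 0 m.+1]).
  - apply/allP => z /mapP[i]; rewrite mem_iota add0n => /= lt_i ->.
    by rewrite rootE; apply/negPn/(q0 (Ordinal lt_i)).
  - rewrite map_inj_in_uniq ?iota_uniq // => i j.
    rewrite !mem_iota !add0n => /= lt_i lt_j /eqP.
    by rewrite (eq_prim_root_expr prim_w) !modn_small // => /eqP.
  - by rewrite size_map size_iota size_poly.
(* Expanding a v(y) by the eigenvalue equation and summing over y first shows that a and l_k
   multiply the transform at k to the same value. *)
exists k; apply: (mulIf nz_qk); rewrite qE mulr_sumr mulr_sumr.
transitivity (\sum_(y < m.+1) \sum_(z < m.+1)
    v z * (circ_adj S z y)%:R * w ^+ (k * y)).
  by apply: eq_bigr => y _; rewrite mulrA -vA mulr_suml.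
rewrite exchange_big /=; apply: eq_bigr => z _.
rewrite mulrCA [circ_eig _ _ _ * _]mulrC -sum_prim_expr_adj mulr_sumr.
by apply: eq_bigr => y _; rewrite mulrA.
Qed.

End CirculantSpectrum.

(** * Rational relations between the p-th roots of unity *)

Lemma prim_root_prime_relation (m : nat) (w : algC) (c : 'I_m.+1 -> rat) :
    prime m.+1 -> m.+1.-primitive_root w ->
    \sum_i ratr (c i) * w ^+ i = 0 ->
  forall i j, c i = c j.
Proof.
move=> p_pr prim_w cw0.
suff cmax i : c i = c ord_max by move=> i j; rewrite !cmax.
have sum_w : \sum_(j < m.+1) w ^+ j = 0.
  have w1 : w - 1 != 0.
    rewrite subr_eq0 -(expr1 w) -(prim_order_dvd prim_w).
    by rewrite dvdn1 neq_ltn prime_gt1 ?orbT.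
  by apply: (mulfI w1); rewrite mulr0 -subrX1 (prim_expr_order prim_w) subrr.
(* Subtracting [c ord_max] times the vanishing sum of all powers removes the top term, so [w] is a
   root of [q], of degree below m. The minimal polynomial of [w] is cyclotomic of degree m, hence
   [q] = 0. *)
pose q := \poly_(j < m) (c (inord j) - c ord_max).
have qw : root (map_poly (ratr : rat -> algC) q) w.
  rewrite rootE; apply/eqP; rewrite (@horner_coef_wide _ m); last first.
    by rewrite size_map_poly size_poly.
  transitivity (\sum_(j < m.+1) (ratr (c j - c ord_max) : algC) * w ^+ j).
    rewrite big_ord_recr /= subrr rmorph0 mul0r addr0; apply: eq_bigr => j _.
    rewrite coef_map coef_poly ltn_ord /=; congr (ratr (c _ - _) * _).
    by apply: val_inj; rewrite /= inordK // ltnW // ltnS.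
  under eq_bigr do rewrite rmorphB mulrBl.
  by rewrite sumrB cw0 -mulr_sumr sum_w mulr0 subrr.
have [r [defr _] rP] := minCpolyP w.
have size_r : size r = m.+1.
  rewrite -(size_map_poly (ratr : {rmorphism rat -> algC})) -defr.
  by rewrite (minCpoly_cyclotomic prim_w) size_cyclotomic totient_prime.
have q0 : q = 0.
  apply/eqP; rewrite rP in qw; apply: contraLR qw => nz_q.
  apply/negP => /(dvdp_leq nz_q); rewrite size_r leqNgt ltnS size_poly //.
have [-> // | ne_i] := eqVneq i ord_max.
have lt_im : (i < m)%N.
  by rewrite ltn_neqAle -ltnS ltn_ord andbT; apply: contra ne_i => /eqP ?;
    apply/eqP/val_inj.
have /polyP/(_ i) := q0; rewrite coef_poly lt_im inord_val coef0.
by move/eqP; rewrite subr_eq0 => /eqP.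
Qed.

(** * Dilations of connection sets *)

Lemma mulrn_inj_prime (m k : nat) :
  prime m.+1 -> ~~ (m.+1 %| k)%N -> injective (fun x : 'I_m.+1 => x *+ k).
Proof.
move=> p_pr ndvd x y /= /eqP; rewrite -subr_eq0 -mulrnBl => /eqP.
rewrite Zp_mulrn => /(congr1 val) /= /eqP; rewrite -/(dvdn _ _) Euclid_dvdM //.
rewrite (negPf ndvd) orbF => dv; apply/eqP; rewrite -subr_eq0.
by rewrite -val_eqE /= -[X in X == _](modn_mod) -/(dvdn _ _).
Qed.

(** If T = {t}, then t = -t, so 2t = 0 and t = 0 in odd order. This excludes the trivial character
    in the comparison of eigenvalues below. *)
Lemma set_opp_neq1 (m : nat) (T : {set 'I_m.+1}) :
  odd m.+1 -> 0 \notin T -> T = [set - x | x in T] -> #|T| != 1%N.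
Proof.
move=> odd_p T0 TN; apply: contraNN T0 => /cards1P[t defT].
have : - t \in T by rewrite TN imset_f // defT set11.
rewrite {1}defT inE eq_sym -addr_eq0 -mulr2n Zp_mulrn -val_eqE /=.
rewrite -/(dvdn _ _) Gauss_dvdl ?coprimen2 // => /dvdnP[[|q] tE].
  by rewrite defT inE -val_eqE /= tE.
by have := ltn_ord t; rewrite tE mulSn ltnNge leq_addr.
Qed.

Lemma circ_eig_eq_dilation (m : nat) (w : algC) (S T : {set 'I_m.+1})
    (e : bool) (k : nat) :
    prime m.+1 -> odd m.+1 -> m.+1.-primitive_root w ->
    S != set0 -> 0 \notin S -> 0 \notin T -> T = [set - x | x in T] ->
    circ_eig w S 1 = (-1) ^+ e * circ_eig w T k ->
  ~~ (m.+1 %| k)%N /\ S = [set x *+ k | x in T].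
Proof.
move=> p_pr odd_p prim_w /set0Pn[s Ss] S0 T0 TN eqST.
(* [N i] is the coefficient of w^i in l_k(T). The coefficients of l_1(S) - (-1)^e l_k(T) are all
   equal, hence equal to the one at 0, where S contributes nothing. *)
pose N (i : 'I_m.+1) := #|[set t in T | t *+ k == i]|.
have relN i : (i \in S)%:R - (-1) ^+ e * (N i)%:R
            = - ((-1) ^+ e * (N 0)%:R) :> rat.
  pose c i : rat := (i \in S)%:R - (-1) ^+ e * (N i)%:R.
  rewrite -[LHS]/(c i); suff -> : c i = c 0 by rewrite /c (negPf S0) sub0r.
  apply: (@prim_root_prime_relation m w c) => //.
  transitivity (circ_eig w S 1 - (-1) ^+ e * circ_eig w T k); last first.
    by rewrite eqST subrr.
  under eq_bigr do
    rewrite rmorphB rmorphM rmorph_sign !rmorph_nat mulrBl -mulrA.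
  rewrite sumrB -mulr_sumr; congr (_ - _ * _).
    rewrite /circ_eig [RHS]big_mkcond /=; apply: eq_bigr => j _.
    by rewrite mul1n; case: ifP; rewrite ?mul1r ?mul0r.
  rewrite /circ_eig [RHS](partition_big (fun t => t *+ k) predT) //=.
  apply: eq_bigr => j _; rewrite /N -sum1dep_card natr_sum mulr_suml.
  apply: eq_bigr => t /andP[_ /eqP <-].
  by rewrite mul1r (prim_expr_mulrn prim_w).
(* If p divides k, all of T is sent to 0; comparing the coefficients at s and at 0 gives 1 = -(-1)^e
   #|T|, so T would be a singleton. *)
have [dv_k | ndv_k] := boolP (m.+1 %| k)%N.
  have Nk t : t *+ k = 0 :> 'I_m.+1.
    by apply/val_inj; rewrite Zp_mulrn /=; apply/eqP/dvdn_mull.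
  have N0 : N 0 = #|T| by apply: eq_card => t; rewrite inE Nk eqxx andbT.
  have nz_s : s != 0 by apply: contraNneq S0 => <-.
  have Ns : N s = 0%N.
    by apply/eqP; rewrite cards_eq0; apply/eqP/setP => t;
      rewrite !inE Nk eq_sym (negPf nz_s) andbF.
  have /(congr1 Num.norm)/eqP := relN s; rewrite Ss Ns N0 mulr0 subr0.
  rewrite normrN normrM normr_sign mul1r !normr_nat eqr_nat eq_sym => T1.
  by case/negP: (set_opp_neq1 odd_p T0 TN).
split=> //; have inj_k := mulrn_inj_prime p_pr ndv_k.
(* Only 0 is sent to 0, and 0 is not in T, so the common coefficient vanishes. *)
have N0 : N 0 = 0%N.
  apply/eqP; rewrite cards_eq0; apply/eqP/setP => t; rewrite !inE.
  apply/andP => -[Tt /eqP tk0]; move/negP: T0; apply.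
  by rewrite -(inj_k t 0) //= mul0rn.
have {}relN i : (i \in S)%:R = (-1) ^+ e * (N i)%:R :> rat.
  by apply/eqP; rewrite -subr_eq0 relN N0 mulr0 oppr0.
(* At s in S the relation reads 1 = (-1)^e N(s), and N(s) is nonnegative. *)
have e0 : e = false.
  apply/negP => e1; have := relN s; rewrite Ss e1 expr1 mulN1r => /eqP.
  by rewrite -addr_eq0 -natrD pnatr_eq0.
apply/setP => i; have /eqP := relN i; rewrite e0 mul1r eqr_nat => /eqP Ni.
apply/idP/imsetP => [Si | [t Tt def_i]].
  have : (0 < N i)%N by rewrite -Ni Si.
  by rewrite card_gt0 => /set0Pn[t]; rewrite inE => /andP[Tt /eqP]; exists t.
have : (0 < N i)%N.
  by rewrite card_gt0; apply/set0Pn; exists t; rewrite inE Tt def_i /=.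
by rewrite -Ni; case: (i \in S).
Qed.

(** * From absolute spectra to isomorphism *)

Lemma circ_abs_spectrum_dilation (m : nat) (S T : {set 'I_m.+1})
    (S0 : 0 \notin S) (SN : S = [set - x | x in S])
    (T0 : 0 \notin T) (TN : T = [set - x | x in T]) (F H : sgraph) :
    prime m.+1 -> odd m.+1 ->
    graph_iso F (circ_graph S0 SN) -> graph_iso H (circ_graph T0 TN) ->
    {subset nz_abs_spectrum F <= nz_abs_spectrum H} -> S != set0 ->
  exists2 k, ~~ (m.+1 %| k)%N & S = [set x *+ k | x in T].
Proof.
move=> p_pr odd_p isoF isoH subFH nz_S.
have [w prim_w] := C_prim_root_exists (ltn0Sn m).
(* A zero l_1(S) would equal the eigenvalue of the empty set, making S a dilation of the empty
   set. *)
have nz_l : circ_eig w S 1 != 0.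
  apply: contraNneq (nz_S) => l0.
  have opp0 : set0 = [set - x | x in set0] :> {set 'I_m.+1} by rewrite imset0.
  have [] := @circ_eig_eq_dilation m w S set0 false 1 p_pr odd_p prim_w nz_S S0
    _ opp0; rewrite ?inE // ?l0 /circ_eig ?big_set0 ?mulr0 //.
  by move=> _ ->; rewrite imset0.
have lF : `|circ_eig w S 1| \in nz_abs_spectrum F.
  apply/nz_abs_spectrumP; exists (circ_eig w S 1); split=> //.
  apply: graph_iso_eigenvalue (graph_iso_sym isoF) _.
  exact: eigenvalue_circ_eig.
have /nz_abs_spectrumP[a [Ha _ abs_a]] := subFH _ lF.
have [k def_a] := eigenvalue_circP prim_w (graph_iso_eigenvalue isoH Ha).
have [e eqST] : exists e : bool, circ_eig w S 1 = (-1) ^+ e * circ_eig w T k.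
  have /eqP : circ_eig w S 1 ^+ 2 = circ_eig w T k ^+ 2.
    rewrite -(real_normK (circ_eig_real prim_w 1 SN)) abs_a def_a.
    by rewrite (real_normK (circ_eig_real prim_w k TN)).
  rewrite eqf_sqr => /orP[] /eqP ->; first by exists false; rewrite mul1r.
  by exists true; rewrite expr1 mulN1r.
have [] := circ_eig_eq_dilation p_pr odd_p prim_w nz_S S0 T0 TN eqST.
by exists k.
Qed.

Lemma dilation_graph_iso (m k : nat) (S T : {set 'I_m.+1})
    (S0 : 0 \notin S) (SN : S = [set - x | x in S])
    (T0 : 0 \notin T) (TN : T = [set - x | x in T]) :
    prime m.+1 -> ~~ (m.+1 %| k)%N -> S = [set x *+ k | x in T] ->
  graph_iso (circ_graph T0 TN) (circ_graph S0 SN).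
Proof.
move=> p_pr ndv_k defS; have inj_k := mulrn_inj_prime p_pr ndv_k.
exists (fun x : 'I_m.+1 => x *+ k); first exact: injF_bij.
by move=> x y; rewrite /= /circ_adj defS -mulrnBl (mem_imset _ _ inj_k).
Qed.

Theorem theorem5p4 (p : nat) (hp : prime p) (hodd : odd p) (F H : sgraph)
  (hF : circulant p F) (hH : circulant p H)
  (hFH : singularly_cospectral F H) : graph_iso F H.
Proof.
have [m [S [S0 [SN [def_p isoF]]]]] := hF.
have [m' [T [T0 [TN [def_p' isoH]]]]] := hH.
move: def_p'; rewrite def_p => -[def_m']; subst p m'.
have eq_spec := perm_mem hFH.2.
suff isoTS : graph_iso (circ_graph T0 TN) (circ_graph S0 SN).
  exact: graph_iso_trans isoF (graph_iso_sym (graph_iso_trans isoH isoTS)).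
(* The dilation argument starts from a nonempty connection set. When S is empty, exchanging the two
   graphs shows that T is empty too. *)
have [S_eq0 | nz_S] := eqVneq S set0; last first.
  have [|k] := circ_abs_spectrum_dilation hp hodd isoF isoH _ nz_S.
    by move=> b; rewrite eq_spec.
  exact: dilation_graph_iso.
have [T_eq0 | nz_T] := eqVneq T set0.
  apply: (@dilation_graph_iso m 1) => //; last by rewrite S_eq0 T_eq0 imset0.
  by rewrite dvdn1 neq_ltn prime_gt1 ?orbT.
have [|k _ defT] := circ_abs_spectrum_dilation hp hodd isoH isoF _ nz_T.
  by move=> b; rewrite eq_spec.
by case/eqP: nz_T; rewrite defT S_eq0 imset0.
Qed.
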